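(* Let $p > 3$ be a prime such that $p \equiv 5 \pmod 8$ or $p \equiv 7 \pmod{8}$. Then for all integers $k, m \geq 0$ with $p \nmid m$, $$\overline{spt2}\left(32p^{2k+1}m + 24p^{2k+2} \right) \equiv 0 \pmod{4}.$$
   Context: An overpartition of a positive integer $n$ is a partition of $n$ (a non-increasing sequence of positive integers with sum $n$) in which the first occurrence of each distinct part may or may not be overlined. The function $\overline{spt2}(n)$ is the total number of smallest parts in the overpartitions of $n$ whose smallest part is even and is not overlined. That is, $\overline{spt2}(n)$ is the sum, over all overpartitions of $n$ whose smallest part is even and has no overlined occurrence, of the number of times the smallest part occurs. For example, $\overline{spt2}(4)=3$: among the 14 overpartitions of $4$, the ones that contribute are $4$ (contributing 1) and $2+2$ (contributing 2). *)

(* Defs.v *)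
From mathcomp Require Import all_boot.

Set Implicit Arguments.
Unset Strict Implicit.
Unset Printing Implicit Defensive.

(* A part is a pair (value, overlined?). *)
Definition parts (s : seq (nat * bool)) : seq nat := unzip1 s.

(* In a non-increasing sequence equal parts are contiguous, so an entry is a
   first occurrence exactly when it differs from the entry just before it. *)
Definition overpart_step (x y : nat * bool) : bool :=
  (y.1 <= x.1) && (y.2 ==> (y.1 != x.1)).

Definition is_overpartition (n : nat) (s : seq (nat * bool)) : bool :=
  [&& sorted overpart_step s, all (fun a => 0 < a) (parts s)
    & sumn (parts s) == n].

(* The sequences are non-increasing, so the smallest part is the last one. *)
Definition smallest_part (s : seq (nat * bool)) : nat := last 0 (parts s).

Definition smallest_part_even_nonoverlined (s : seq (nat * bool)) : bool :=
  ~~ odd (smallest_part s) && ((smallest_part s, true) \notin s).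

(* Parts and length of an overpartition of n are at most n (see
   [is_overpartition_bounded]), so all of them occur, exactly once each, in
   the finite type of sequences of length at most n over 'I_n.+1 * bool. *)
Definition seq_of_bseq (n : nat) (t : {bseq n of 'I_n.+1 * bool}) :
    seq (nat * bool) :=
  [seq (nat_of_ord x.1, x.2) | x <- t].

Lemma is_overpartition_bounded (n : nat) (s : seq (nat * bool)) :
  is_overpartition n s -> exists t, seq_of_bseq (n := n) t = s.
Proof.
case/and3P=> _ pos /eqP sum_s.
have size_le : forall r, all (fun a => 0 < a) r -> size r <= sumn r.
  elim=> //= a r IHr /andP[a_gt0 /IHr le_r].
  by rewrite -add1n leq_add.
have part_le : forall a r, a \in r -> a <= sumn r.
  move=> a; elim=> //= b r IHr; rewrite inE => /orP[/eqP-> | /IHr le_a].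
    exact: leq_addr.
  exact: leq_trans le_a (leq_addl _ _).
pose u := [seq (inord x.1 : 'I_n.+1, x.2) | x <- s].
have size_u : size u <= n.
  by rewrite size_map -sum_s -(size_map fst s); apply: size_le.
exists (Bseq size_u); rewrite /seq_of_bseq /= -map_comp -[RHS]map_id.
apply/eq_in_map=> -[a b] ab_s /=; rewrite inordK // ltnS -sum_s.
exact/part_le/(map_f fst ab_s).
Qed.

Lemma seq_of_bseq_inj (n : nat) : injective (@seq_of_bseq n).
Proof.
move=> t1 t2 /inj_map eq12; apply/val_inj/eq12 => -[a1 b1] [a2 b2] [].
by move/val_inj=> -> ->.
Qed.

Definition spt2bar (n : nat) : nat :=
  \sum_(t : {bseq n of 'I_n.+1 * bool}
         | is_overpartition n (seq_of_bseq t)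
           && smallest_part_even_nonoverlined (seq_of_bseq t))
    count_mem (smallest_part (seq_of_bseq t)) (parts (seq_of_bseq t)).

(* Main.v *)
(* The argument N equals 8M with M = 3 mod 4, and N is not of the form
   x^2 + 2y^2: p divides M to an odd power and -2 is not a square mod p.
   A partition with r part sizes above its smallest part underlies 2^r
   overpartitions, so modulo 4 only partitions with one or two part sizes count:
     spt2bar(N) = sum_{dj = N, d even} j
                  + 2 #{ai + bj = N : a > b, b even, j odd}   (mod 4).
   Exchanging the odd parts of d and j pairs the terms of the first sum into
   multiples of 4, since the product of these odd parts is M = 3 mod 4.  For the
   count, any set of solutions of xu + yv = N cut out by the parities of x, u, y,
   v alone is even: exchanging the odd parts of x and u, or of y and v, can only
   fix representations N = 2^e r^2 + 2^f s^2, and there are none.  The condition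
   a > b is removed by conjugation.  If a is even, conjugation maps the solutions
   onto an unordered parity class.  If a is odd, the solutions with a < b complete
   them to a parity class and are conjugate to the all-odd solutions with x > y,
   which are counted by comparing xu with yv instead of x with y. *)
Require Import Defs.
From mathcomp Require Import all_boot.
From mathcomp Require Import zify.

Set Implicit Arguments.
Unset Strict Implicit.
Unset Printing Implicit Defensive.

(** * Sums over sequences and involutions *)

(** Induction on the size removes [x] together with its partner [f x]. Since [f] is injective on
    [s], it still maps the remaining entries to each other. *)
Lemma sum_involution_dvd (T : eqType) (d : nat) (w : T -> nat) (f : T -> T)
    (s : seq T) :
  uniq s ->
  (forall x, x \in s ->
     [/\ f x \in s, f (f x) = x, f x != x & d %| w x + w (f x)]) ->
  d %| \sum_(x <- s) w x.
Proof.
have [n] := ubnP (size s); elim: n s => // n IHn [|x s] /=.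
  by rewrite big_nil dvdn0.
move=> lt_s /andP[x_s uniq_s] Hf.
have [fx_xs fK fx dw] := Hf x (mem_head _ _).
have fx_s : f x \in s by move: fx_xs; rewrite inE (negPf fx).
rewrite big_cons (big_rem _ fx_s) /= addnA dvdn_add //.
apply: IHn; rewrite ?rem_uniq //.
  by rewrite size_rem //; case: (s) fx_s lt_s => //= ? ? _; lia.
move=> y; rewrite (mem_rem_uniq _ uniq_s) !inE => /andP[y_fx y_s].
have [fy_xs fyK fy dwy] : [/\ f y \in x :: s, f (f y) = y, f y != y
    & d %| w y + w (f y)] by apply: Hf; rewrite inE y_s orbT.
split=> //; rewrite (mem_rem_uniq _ uniq_s) !inE.
have fy_x : f y != x by apply: contraNneq y_fx => <-; rewrite fyK.
move: fy_xs; rewrite inE (negPf fy_x) /= => ->; rewrite andbT.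
by apply: contraNneq x_s => /(congr1 f); rewrite fyK fK => <-.
Qed.

Lemma sum_bij_seq (S T : eqType) (f : S -> T) (g : T -> S)
    (s : seq S) (t : seq T) (w : S -> nat) (v : T -> nat) :
  uniq s -> uniq t ->
  (forall x, x \in s -> [/\ f x \in t, g (f x) = x & v (f x) = w x]) ->
  (forall y, y \in t -> g y \in s /\ f (g y) = y) ->
  \sum_(x <- s) w x = \sum_(y <- t) v y.
Proof.
move=> uniq_s uniq_t Hf Hg.
rewrite big_seq (eq_bigr (fun x => v (f x))) => [|x /Hf[]//].
rewrite -big_seq -(big_map f xpredT v); apply: perm_big; apply: uniq_perm => //.
  rewrite map_inj_in_uniq // => x y /Hf[_ fxK _] /Hf[_ fyK _] eq_f.
  by rewrite -fxK eq_f.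
move=> y; apply/mapP/idP => [[x /Hf[fx _ _] ->] // | /Hg[gy gK]].
by exists (g y).
Qed.

Lemma count_bij_seq (S T : eqType) (f : S -> T) (g : T -> S)
    (s : seq S) (t : seq T) (P : pred S) (Q : pred T) :
  uniq s -> uniq t ->
  (forall x, x \in s -> P x -> [/\ f x \in t, Q (f x) & g (f x) = x]) ->
  (forall y, y \in t -> Q y -> [/\ g y \in s, P (g y) & f (g y) = y]) ->
  count P s = count Q t.
Proof.
move=> uniq_s uniq_t Hf Hg; rewrite -!size_filter -!sum1_size.
apply: (sum_bij_seq (f := f) (g := g)); rewrite ?filter_uniq // => z;
  rewrite mem_filter => /andP[].
  by move=> Pz zs; have [? ? ?] := Hf z zs Pz; rewrite mem_filter; split=> //; apply/andP.
by move=> Qz zt; have [? ? ?] := Hg z zt Qz; rewrite mem_filter; split=> //; apply/andP.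
Qed.

Lemma even_count_involution (T : eqType) (f : T -> T) (s : seq T) (P : pred T) :
  uniq s ->
  (forall x, x \in s -> P x -> [/\ f x \in s, P (f x), f (f x) = x & f x != x]) ->
  ~~ odd (count P s).
Proof.
move=> uniq_s Hf; rewrite -dvdn2 -size_filter -sum1_size.
apply: (sum_involution_dvd (f := f)); rewrite ?filter_uniq // => x.
rewrite mem_filter => /andP[Px xs]; have [fs Pf fK ne] := Hf x xs Px.
by rewrite mem_filter Pf fs.
Qed.

(** * Partitions with at most two part sizes *)

Definition pairs (n : nat) : seq (nat * nat) :=
  [seq (a, i) | a <- iota 1 n, i <- iota 1 n].

(* [((a, i), (b, j))] stands for the partition [a^i b^j] of [n]. *)
Definition quads (n : nat) : seq ((nat * nat) * (nat * nat)) :=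
  [seq q <- [seq (x, y) | x <- pairs n, y <- pairs n]
     | q.1.1 * q.1.2 + q.2.1 * q.2.2 == n].

Lemma pairs_uniq n : uniq (pairs n).
Proof. by apply: allpairs_uniq; rewrite ?iota_uniq // => -[? ?] []. Qed.

Lemma mem_pairs n a i : ((a, i) \in pairs n) = (0 < a <= n) && (0 < i <= n).
Proof.
apply/allpairsP/idP => [[[b j] /= [] + + [-> ->]]|]; rewrite ?mem_iota.
  by lia.
by move=> h; exists (a, i); rewrite /= !mem_iota; split=> //; lia.
Qed.

Lemma quads_uniq n : uniq (quads n).
Proof.
by rewrite filter_uniq // allpairs_uniq ?pairs_uniq // => -[? ?] [].
Qed.

Lemma mem_quads n a i b j : (((a, i), (b, j)) \in quads n) =
  [&& 0 < a, 0 < i, 0 < b, 0 < j & a * i + b * j == n].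
Proof.
rewrite mem_filter /=; apply/andP/idP => [[/eqP eq_n]|].
  case/allpairsP => -[x y] /= [xP yP [eq_x eq_y]]; subst x y.
  by move: xP yP; rewrite !mem_pairs eq_n eqxx; lia.
have leq_addr_pmul u v w : 0 < v -> u <= u * v + w.
  by move=> v0; apply: leq_trans (leq_addr _ _); rewrite leq_pmulr.
case/and5P=> a0 i0 b0 j0 /eqP eq_n; rewrite eq_n eqxx; split=> //.
apply/allpairsP; exists ((a, i), (b, j)); split=> //; rewrite mem_pairs -eq_n.
  by rewrite a0 i0 !leq_addr_pmul // [a * i]mulnC leq_addr_pmul.
by rewrite b0 j0 ![_ + b * j]addnC !leq_addr_pmul // [b * j]mulnC leq_addr_pmul.
Qed.

(** With a = 2^s u and i = 2^t v for odd u, v, the image is (2^s v, 2^t u). The powers of 2 stay in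
    place, so both parities survive along with the product. *)
Definition swap_odd_parts (x : nat * nat) : nat * nat :=
  (x.1`_2 * x.2`_2^', x.2`_2 * x.1`_2^').

Lemma odd_partn2' n : odd n`_2^'.
Proof. by rewrite odd_2'nat part_pnat. Qed.

Lemma odd_partn2 n : 0 < n -> odd n`_2 = odd n.
Proof.
by move=> n0; rewrite -[in RHS](partnC 2 n0) oddM odd_partn2' andbT.
Qed.

Lemma swap_odd_parts_props a i : 0 < a -> 0 < i ->
  exists a' i', swap_odd_parts (a, i) = (a', i') /\
    [/\ 0 < a', 0 < i', a' * i' = a * i, odd a' = odd a & odd i' = odd i].
Proof.
move=> a0 i0; eexists; eexists; split; first reflexivity.
split; rewrite ?muln_gt0 ?part_gt0 //.
- by rewrite [i`_2 * _]mulnC mulnACA [_ * i`_2]mulnC !partnC.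
- by rewrite oddM odd_partn2 // odd_partn2' andbT.
- by rewrite oddM odd_partn2 // odd_partn2' andbT.
Qed.

Lemma swap_odd_partsK a i : 0 < a -> 0 < i ->
  swap_odd_parts (swap_odd_parts (a, i)) = (a, i).
Proof.
move=> a0 i0; rewrite /swap_odd_parts /=.
rewrite !partnM ?part_gt0 //.
have H2 n : (n`_2)`_2 = n`_2 by rewrite part_pnat_id // part_pnat.
have H2' n : (n`_2^')`_2^' = n`_2^' by rewrite part_pnat_id // part_pnat.
have H0 n : (n`_2^')`_2 = 1 by apply: part_p'nat; rewrite part_pnat.
have H0' n : (n`_2)`_2^' = 1.
  by apply: part_p'nat; rewrite pnatNK part_pnat.
by rewrite !H2 !H2' !H0 !H0' !muln1 !mul1n !partnC.
Qed.

(** At a fixed point the two odd parts are equal, so their product is a square and only a power of 2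
    remains. *)
Lemma swap_odd_parts_fixed a i : 0 < a -> 0 < i -> swap_odd_parts (a, i) = (a, i) ->
  exists e x, a * i = 2 ^ e * x ^ 2.
Proof.
move=> a0 i0 [eq_a _]; exists (logn 2 a + logn 2 i), (a`_2^').
have: i`_2^' = a`_2^'.
  have := eq_a; rewrite -{2}(partnC 2 a0) => /eqP.
  by rewrite eqn_pmul2l ?part_gt0 // => /eqP.
move=> eq_i; rewrite -{1}(partnC 2 a0) -{1}(partnC 2 i0) eq_i !p_part expnD.
by rewrite mulnACA.
Qed.

(* [P] only sees the parities of the four entries and the two products, which
   are the quantities left unchanged by [swap_odd_parts]; a fixed point of the
   involution would give a representation of [n]. *)
Lemma even_count_parity_class (n : nat) (P : bool -> bool -> bool -> bool -> nat -> nat -> bool) :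
  (forall e f x y, 2 ^ e * x ^ 2 + 2 ^ f * y ^ 2 <> n) ->
  ~~ odd (count (fun q => P (odd q.1.1) (odd q.1.2) (odd q.2.1) (odd q.2.2)
                            (q.1.1 * q.1.2) (q.2.1 * q.2.2)) (quads n)).
Proof.
move=> no_rep.
(* Swap the second pair if that moves it, else the first. A moved pair is moved back by the next
   swap, and a fixed second pair is left alone, so the same branch is taken again and [f] is an
   involution. *)
pose f (q : (nat * nat) * (nat * nat)) :=
  if swap_odd_parts q.2 != q.2 then (q.1, swap_odd_parts q.2)
  else (swap_odd_parts q.1, q.2).
apply: (even_count_involution (f := f)); first exact: quads_uniq.
move=> [[a i] [b j]]; rewrite mem_quads => /and5P[a0 i0 b0 j0 /eqP eq_n] /= Pq.
have [a' [i' [sa [a'0 i'0 ea oa oi]]]] := swap_odd_parts_props a0 i0.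
have [b' [j' [sb [b'0 j'0 eb ob oj]]]] := swap_odd_parts_props b0 j0.
have := swap_odd_partsK a0 i0; have := swap_odd_partsK b0 j0.
rewrite /f sa sb [_.2]/= [_.1]/=; case: (eqVneq (b', j') (b, j)) => [fix_b _|ne_b].
  case: (eqVneq (a', i') (a, i)) => [fix_a|ne_a] Ka.
    have [e [x eq_a]] := swap_odd_parts_fixed a0 i0 (etrans sa fix_a).
    have [e' [y eq_b]] := swap_odd_parts_fixed b0 j0 (etrans sb fix_b).
    by case: (no_rep e e' x y); rewrite -eq_a -eq_b.
  rewrite [_.2]/= [_.1]/= sb fix_b eqxx Ka /= ea oa oi; split=> //.
    by rewrite mem_quads; apply/and5P; split=> //; apply/eqP; rewrite ea.
  by apply: contraNneq ne_a => -[-> ->].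
move=> Kb Ka; rewrite [_.2]/= [_.1]/= Kb eq_sym ne_b /= eb ob oj; split=> //.
  by rewrite mem_quads; apply/and5P; split=> //; apply/eqP; rewrite eb.
by apply: contraNneq ne_b => -[-> ->].
Qed.

(** The all-odd solutions are counted in two ways. Comparing the two products gives twice an even
    number, hence a multiple of 4. Comparing [q.1.1] with [q.2.1] gives twice the wanted count plus
    the diagonal, which is itself twice an even number. So twice the wanted count is divisible by
    4. *)
Lemma even_count_all_odd (M : nat) :
  (forall e f x y, 2 ^ e * x ^ 2 + 2 ^ f * y ^ 2 <> 8 * M) ->
  ~~ odd (count (fun q => [&& odd q.1.1, odd q.1.2, odd q.2.1, odd q.2.2
                            & q.2.1 < q.1.1]) (quads (8 * M))).
Proof.
move=> no_rep.
pose odds (q : (nat * nat) * (nat * nat)) :=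
  [&& odd q.1.1, odd q.1.2, odd q.2.1 & odd q.2.2].
pose xch (q : (nat * nat) * (nat * nat)) := (q.2, q.1).
have count_split3 (u v : (nat * nat) * (nat * nat) -> nat) s :
  count odds s = count (fun q => odds q && (u q < v q)) s
     + count (fun q => odds q && (v q < u q)) s
     + count (fun q => odds q && (u q == v q)) s.
  by elim: s => //= q s ->; case: (odds q); case: ltngtP => _ /=; lia.
have big_odds := count_split3 (fun q => q.2.1) (fun q => q.1.1) (quads (8 * M)).
have prod_odds :=
  count_split3 (fun q => q.1.1 * q.1.2) (fun q => q.2.1 * q.2.2) (quads (8 * M)).
have sym_big : count (fun q => odds q && (q.1.1 < q.2.1)) (quads (8 * M)) =
    count (fun q => odds q && (q.2.1 < q.1.1)) (quads (8 * M)).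
  apply: (count_bij_seq (f := xch) (g := xch)); rewrite ?quads_uniq //.
    by move=> [[a i] [b j]]; rewrite !mem_quads /odds /=; split=> //; lia.
  by move=> [[a i] [b j]]; rewrite !mem_quads /odds /=; split=> //; lia.
have sym_prod : count (fun q => odds q && (q.2.1 * q.2.2 < q.1.1 * q.1.2)) (quads (8 * M)) =
    count (fun q => odds q && (q.1.1 * q.1.2 < q.2.1 * q.2.2)) (quads (8 * M)).
  apply: (count_bij_seq (f := xch) (g := xch)); rewrite ?quads_uniq //.
    by move=> [[a i] [b j]]; rewrite !mem_quads /odds /=; split=> //; lia.
  by move=> [[a i] [b j]]; rewrite !mem_quads /odds /=; split=> //; lia.
(* Equal odd products would make 8M twice an odd number. *)
have no_eq_prod : count (fun q => odds q && (q.1.1 * q.1.2 == q.2.1 * q.2.2))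
    (quads (8 * M)) = 0.
  apply/eqP; rewrite -leqn0 leqNgt -has_count; apply/hasPn.
  move=> [[a i] [b j]]; rewrite mem_quads /odds /= => /and5P[_ _ _ _ /eqP eq_n].
  apply/negP => /andP[/and4P[oa oi ob oj] /eqP eq_p].
  have: odd (a * i) by rewrite oddM oa oi.
  by move: eq_n; rewrite -eq_p; lia.
(* The order of the two products is visible to a parity class, because exchanging odd parts
   preserves each product; the order of [q.1.1] and [q.2.1] is not. *)
have even_prod : ~~ odd (count (fun q => odds q && (q.1.1 * q.1.2 < q.2.1 * q.2.2))
    (quads (8 * M))).
  exact: (even_count_parity_class (fun a i b j x y => [&& a, i, b & j] && (x < y)) no_rep).
pose diag (q : (nat * nat) * (nat * nat)) := odds q && (q.2.1 == q.1.1).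
have diag_split : count diag (quads (8 * M)) =
    count (fun q => diag q && (q.1.2 < q.2.2)) (quads (8 * M)) +
    count (fun q => diag q && (q.2.2 < q.1.2)) (quads (8 * M)).
  have diag_ne q : q \in quads (8 * M) -> diag q -> q.1.2 != q.2.2.
    case: q => [[a i] [b j]]; rewrite mem_quads /diag /odds /=.
    move=> /and5P[_ _ _ _ /eqP eq_n] /andP[/and4P[oa oi ob oj] /eqP eq_b].
    apply/eqP => eq_i; subst b j; have: odd (a * i) by rewrite oddM oa oi.
    by move: eq_n; lia.
  elim: (quads _) diag_ne => //= q s IHs ne.
  rewrite IHs => [|r rs]; last by apply: ne; rewrite inE rs orbT.
  by have := ne q (mem_head _ _); case: (diag q) => //= /(_ isT);
    case: ltngtP => //= _ _; lia.
have diag_sym : count (fun q => diag q && (q.2.2 < q.1.2)) (quads (8 * M)) =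
    count (fun q => diag q && (q.1.2 < q.2.2)) (quads (8 * M)).
  apply: (count_bij_seq (f := xch) (g := xch)); rewrite ?quads_uniq //.
    by move=> [[a i] [b j]]; rewrite !mem_quads /diag /odds /=; split=> //; lia.
  by move=> [[a i] [b j]]; rewrite !mem_quads /diag /odds /=; split=> //; lia.
(* On the diagonal [x * (i + j) = 8 * M] with [x] odd, so [(i + j) / 2] is a
   multiple of 4 and reflecting [i] about [(i + j) / 4] fixes no odd [i]. *)
have even_diag : ~~ odd (count (fun q => diag q && (q.1.2 < q.2.2)) (quads (8 * M))).
  pose f (q : (nat * nat) * (nat * nat)) := let h := (q.1.2 + q.2.2)./2 in
    ((q.1.1, h - q.1.2), (q.2.1, h + q.1.2)).
  apply: (even_count_involution (f := f)); first exact: quads_uniq.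
  move=> [[a i] [b j]]; rewrite !mem_quads /diag /odds /f /=.
  move=> /and5P[a0 i0 b0 j0 /eqP eq_n] /andP[/andP[/and4P[oa oi ob oj] /eqP eq_b] lt_ij].
  subst b; have: 8 %| i + j.
    rewrite -(Gauss_dvdr _ (_ : coprime 8 a)); last by rewrite (@coprimeXl 3 2) ?coprime2n.
    by rewrite mulnDr eq_n dvdn_mulr.
  case/dvdnP=> h eq_ij; have -> : (i + j)./2 = 4 * h by lia.
  have -> : (4 * h - i + (4 * h + i))./2 = 4 * h by lia.
  have lt_ih : i < 4 * h by lia.
  split; first 1 last; [by rewrite oa /=; lia | | | ].
  - by congr ((_, _), (_, _)); lia.
  - by apply/eqP => -[]; lia.
  by apply/and5P; split=> //; lia.
rewrite (eq_count (a2 := fun q => odds q && (q.2.1 < q.1.1))); last first.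
  by move=> q; rewrite /odds -!andbA.
move: big_odds prod_odds even_prod even_diag diag_split.
rewrite sym_big sym_prod no_eq_prod diag_sym.
rewrite -[X in _ = _ + X]/(count diag _) => ->; move: (count _ _) (count _ _) (count _ _).
lia.
Qed.

(** * Conjugation of partitions with two part sizes *)

Lemma count_split (T : Type) (P R : pred T) (s : seq T) :
  count P s = count (fun x => P x && R x) s + count (fun x => P x && ~~ R x) s.
Proof. by elim: s => //= x s ->; case: (P x) => //=; case: (R x) => /=; lia. Qed.

Lemma mem_quads_swap n x y : ((x, y) \in quads n) = ((y, x) \in quads n).
Proof. by case: x y => [a i] [b j]; rewrite !mem_quads; lia. Qed.

(* The Ferrers conjugate of [a^i b^j] with [b < a] is [(i + j)^b i^(a - b)]. *)
Definition conjugate (q : (nat * nat) * (nat * nat)) : (nat * nat) * (nat * nat) :=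
  ((q.1.2 + q.2.2, q.2.1), (q.1.2, q.1.1 - q.2.1)).

Lemma conjugate_quads n a i b j (q := ((a, i), (b, j))) :
  q \in quads n -> b < a ->
  [/\ conjugate q \in quads n, i < i + j & conjugate (conjugate q) = q].
Proof.
rewrite /q mem_quads => /and5P[a0 i0 b0 j0 /eqP eq_n] lt_ba; split; last 2 first.
- by lia.
- by rewrite /conjugate /=; congr ((_, _), (_, _)); lia.
rewrite mem_quads -eq_n subn_gt0 lt_ba i0 b0 addn_gt0 i0 /=.
rewrite -[in X in _ == X](subnK (ltnW lt_ba)); apply/eqP.
by move: (a - b) => r; lia.
Qed.

Lemma even_count_two_sizes (M : nat) :
  (forall e f x y, 2 ^ e * x ^ 2 + 2 ^ f * y ^ 2 <> 8 * M) ->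
  ~~ odd (count (fun q => [&& q.2.1 < q.1.1, ~~ odd q.2.1 & odd q.2.2])
                (quads (8 * M))).
Proof.
move=> no_rep; rewrite (count_split _ (fun q => odd q.1.1)) oddD.
have even_mixed := even_count_parity_class
  (fun a i b j _ _ => [&& a, ~~ i, ~~ b & j]) no_rep.
have even_conj := even_count_parity_class
  (fun x u y v _ _ => [&& x, ~~ u, ~~ y & ~~ v]) no_rep.
pose xch (q : (nat * nat) * (nat * nat)) := (q.2, q.1).
(* Here a and b are even and j is odd, so b and a - b are even and exactly one of i + j, i is odd.
   The map [f] puts the pair with the odd entry first. The order is recovered by [g], since the
   first pair of a conjugate always has the larger first entry. *)
have -> : count (fun q => [&& q.2.1 < q.1.1, ~~ odd q.2.1 & odd q.2.2]
      && ~~ odd q.1.1) (quads (8 * M)) =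
    count (fun q => [&& odd q.1.1, ~~ odd q.1.2, ~~ odd q.2.1 & ~~ odd q.2.2])
      (quads (8 * M)).
  pose f q := let c := conjugate q in if odd c.1.1 then c else xch c.
  pose g q := conjugate (if q.2.1 < q.1.1 then q else xch q).
  apply: (count_bij_seq (f := f) (g := g)); rewrite ?quads_uniq //.
    move=> [[a i] [b j]] q_n /= /andP[/and3P[lt_ba eb oj] ea].
    have [c_n lt_c cK] := conjugate_quads q_n lt_ba; rewrite /f /=.
    case: ifP => odd_ij; rewrite /g /=; split=> //; try by lia.
    - by rewrite lt_c.
    - by rewrite mem_quads_swap.
    - by rewrite ifF //; lia.
  move=> [[x u] [y v]] q_n /= /and4P[ox eu ey ev].
  rewrite /g /=; case: ltnP => [lt_yx|le_xy].
    have [c_n lt_c cK] := conjugate_quads q_n lt_yx.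
    by split=> //; [rewrite /=; lia | rewrite /f cK /= ox].
  have lt_xy : x < y by rewrite ltn_neqAle le_xy andbT; apply: contraNneq ey => <-.
  have [c_n lt_c cK] : _ := conjugate_quads (etrans (mem_quads_swap _ _ _) q_n) lt_xy.
  by split=> //; [rewrite /=; lia | rewrite /f cK /= (negPf ey)].
rewrite (negPf even_conj) addbF.
move: even_mixed; rewrite (count_split _ (fun q => q.2.1 < q.1.1)) oddD.
(* When a < b, the conjugate of the exchanged quadruple is (i + j)^a j^(b - a). With a, j odd and i,
   b even, all four of its entries are odd. *)
have -> : count (fun q => [&& odd q.1.1, ~~ odd q.1.2, ~~ odd q.2.1 & odd q.2.2]
      && ~~ (q.2.1 < q.1.1)) (quads (8 * M)) =
    count (fun q => [&& odd q.1.1, odd q.1.2, odd q.2.1, odd q.2.2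
                      & q.2.1 < q.1.1]) (quads (8 * M)).
  apply: (count_bij_seq (f := fun q => conjugate (xch q))
    (g := fun q => xch (conjugate q))); rewrite ?quads_uniq //.
    move=> [[a i] [b j]] q_n /= /andP[/and4P[oa ei eb oj]]; rewrite -leqNgt => le_ab.
    have lt_ab : a < b by rewrite ltn_neqAle le_ab andbT; apply: contraTneq oa => ->.
    have [c_n lt_c cK] : _ := conjugate_quads (etrans (mem_quads_swap _ _ _) q_n) lt_ab.
    by rewrite [xch _]/= cK; split=> //; lia.
  move=> [[x u] [y v]] q_n /= /and5P[ox ou oy ov lt_yx].
  have [c_n lt_c cK] := conjugate_quads q_n lt_yx.
  by rewrite mem_quads_swap [xch (xch _)]/= cK; split=> //=; lia.
rewrite (negPf (even_count_all_odd no_rep)) addbF => even_T2.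
(* For a odd and b even, the evenness of 8M already forces i to be even. *)
rewrite (@eq_in_count _ _ (fun q => [&& odd q.1.1, ~~ odd q.1.2, ~~ odd q.2.1 & odd q.2.2]
      && (q.2.1 < q.1.1))) //.
move=> [[a i] [b j]]; rewrite mem_quads /= => /and5P[_ _ _ _ /eqP eq_n].
have : ~~ odd (a * i + b * j) by rewrite eq_n oddM.
rewrite oddD !oddM; case: (odd a); case: (odd i); case: (odd b); case: (odd j) => //=;
  by rewrite ?andbF ?andbT.
Qed.

(** Let u and v be the odd parts of d and j. Then uv = M is 3 mod 4, so one of u, v is 1 and the
    other 3 mod 4, and 4 divides u + v. The paired terms add up to the 2-part of j times u + v. *)
Lemma dvd4_sum_one_size (M : nat) : M = 3 %[mod 4] ->
  (forall e f x y, 2 ^ e * x ^ 2 + 2 ^ f * y ^ 2 <> 8 * M) ->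
  4 %| \sum_(x <- [seq x <- pairs (8 * M) | (x.1 * x.2 == 8 * M) && ~~ odd x.1]) x.2.
Proof.
move=> M_mod no_rep; apply: (sum_involution_dvd (f := swap_odd_parts)).
  by rewrite filter_uniq // pairs_uniq.
move=> [d j]; rewrite mem_filter mem_pairs /= => /andP[/andP[/eqP eq_n ed] le_n].
have d0 : 0 < d by lia.
have j0 : 0 < j by lia.
have [d1 [j1 [eq_dj [d10 j10 eq_p od oj]]]] := swap_odd_parts_props d0 j0.
split.
- rewrite eq_dj mem_filter mem_pairs /= eq_p eq_n eqxx od ed d10 j10 /=.
  by rewrite -eq_n -eq_p leq_pmulr // leq_pmull.
- exact: swap_odd_partsK.
(* A fixed point would write 8M as 2^e x^2, a representation whose second square is 0. *)
- apply/eqP => fix_dj; have [e [x eq_x]] := swap_odd_parts_fixed d0 j0 fix_dj.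
  by apply: (no_rep e 0 x 0); rewrite -eq_x eq_n; lia.
rewrite /swap_odd_parts -{1}(partnC 2 j0) -mulnDr dvdn_mull //.
have eq_M : d`_2^' * j`_2^' = M.
  rewrite -partnM // eq_n partnM //; last by lia.
  have -> : 8`_2^' = 1 by apply: part_p'nat; rewrite pnatNK.
  by rewrite mul1n part_pnat_id // -odd_2'nat; lia.
move: M_mod; rewrite -eq_M -modnMm /dvdn -modnDm.
have := ltn_pmod d`_2^' (isT : 0 < 4); have := ltn_pmod j`_2^' (isT : 0 < 4).
by case: (d`_2^' %% 4) => [|[|[|[|]]]] //; case: (j`_2^' %% 4) => [|[|[|[|]]]].
Qed.

(** * Overpartitions modulo 4 *)

Definition spt2_overpartitions (n : nat) : seq (seq (nat * bool)) :=
  [seq s <- [seq seq_of_bseq t | t <- enum {bseq n of 'I_n.+1 * bool}]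
     | is_overpartition n s && smallest_part_even_nonoverlined s].

Lemma mem_spt2_overpartitions n s : (s \in spt2_overpartitions n) =
  is_overpartition n s && smallest_part_even_nonoverlined s.
Proof.
rewrite mem_filter andb_idr // => /andP[/is_overpartition_bounded[t <-] _].
by rewrite map_f // mem_enum.
Qed.

Lemma spt2_overpartitions_uniq n : uniq (spt2_overpartitions n).
Proof. by rewrite filter_uniq // map_inj_uniq ?enum_uniq //; apply: seq_of_bseq_inj. Qed.

Definition smallest_mult (s : seq (nat * bool)) : nat :=
  count_mem (smallest_part s) (parts s).

Lemma spt2bar_sum n : spt2bar n = \sum_(s <- spt2_overpartitions n) smallest_mult s.
Proof. by rewrite big_filter big_map big_enum_cond. Qed.

(** Only the first entry of value [v] is changed: it is the one occurrence that an overpartition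
    allows to be overlined. *)
Fixpoint toggle (v : nat) (s : seq (nat * bool)) : seq (nat * bool) :=
  if s is x :: r then
    if x.1 == v then (x.1, ~~ x.2) :: r else x :: toggle v r
  else [::].

Lemma toggleK v : involutive (toggle v).
Proof.
by elim=> //= -[a b] r IHr; case: ifP => /= ->; rewrite ?IHr ?negbK.
Qed.

Lemma parts_toggle v s : parts (toggle v s) = parts s.
Proof.
by elim: s => //= -[a b] r IHr; case: ifP => //= _; congr (_ :: _).
Qed.

Lemma toggle_neq v s : v \in parts s -> toggle v s != s.
Proof.
elim: s => //= -[a b] r IHr; rewrite inE eq_sym /=; case: ifP => [_ _|_ /= v_r].
  by apply/eqP => -[]; case: b.
by apply: contraNneq (IHr v_r) => -[->].
Qed.

(** Since [x.1] differs from [v], the entry being toggled follows a different value, so both of its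
    states are legal. Later steps see only its value, which is unchanged. *)
Lemma path_toggle v x s : x.1 != v ->
  path overpart_step x s -> path overpart_step x (toggle v s).
Proof.
elim: s x => //= -[a b] r IHr x ne_x /andP[/andP[/= le_ax step] path_r].
case: ifP => [/eqP eq_a|/negbT ne_a] /=.
  rewrite /overpart_step /= le_ax implybE (_ : a != x.1) ?orbT /=.
    by case: r path_r {IHr}.
  by rewrite eq_a eq_sym.
by rewrite /overpart_step /= le_ax step; apply: IHr.
Qed.

Lemma mem_toggle v x s : x.1 != v -> (x \in toggle v s) = (x \in s).
Proof.
case: x => c d /= ne_c; elim: s => //= -[a b] r IHr; case: ifP => [/= /eqP eq_a|_].
  by rewrite !inE !xpair_eqE eq_a (negPf ne_c).
by rewrite !inE IHr.
Qed.

Lemma toggle_spt2_overpartitions n v s : v != smallest_part s ->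
  s \in spt2_overpartitions n -> toggle v s \in spt2_overpartitions n.
Proof.
rewrite !mem_spt2_overpartitions /is_overpartition /smallest_part_even_nonoverlined.
rewrite /smallest_part !parts_toggle => ne_v.
rewrite mem_toggle 1?eq_sym //= => /andP[/and3P[sorted_s -> ->] ->].
rewrite !andbT; case: s sorted_s {ne_v} => //= -[a b] r path_r.
case: ifP => [_|/negbT ne_a]; first by case: r path_r.
exact: path_toggle.
Qed.

Lemma path_overpart_le x s : path overpart_step x s -> all (fun y => y.1 <= x.1) s.
Proof.
elim: s x => //= y s IHs x /andP[/andP[le_yx _] /IHs /allP le_s].
by rewrite le_yx; apply/allP => z /le_s /leq_trans; apply.
Qed.

(** An entry equal to [x.1] in the tail is a repeated occurrence, because values that have dropped
    below [x.1] never return to it. *)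
Lemma path_overpart_head x s : path overpart_step x s -> (x.1, true) \notin s.
Proof.
elim: s x => //= y s IHs x /andP[/andP[le_yx step] path_s].
rewrite inE negb_or; apply/andP; split.
  by apply: contraTneq step => <- /=; rewrite eqxx.
have [<-|ne_yx] := eqVneq y.1 x.1; first exact: IHs.
apply/negP => /(allP (path_overpart_le path_s)) /= le_xy.
by move: ne_yx; rewrite eqn_leq le_yx le_xy.
Qed.

Lemma sorted_parts s : sorted overpart_step s -> sorted geq (parts s).
Proof.
by rewrite sorted_map; apply: sub_sorted => x y /andP[].
Qed.

Lemma last_sorted_geq l a : sorted geq l -> a \in l -> last 0 l <= a.
Proof.
case: l => // x l; elim: l x a => [|y l IHl] x a /=; first by rewrite inE => _ /eqP->.
move=> /andP[le_yx path_l]; rewrite inE => /orP[/eqP->|]; last exact: IHl.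
by apply: leq_trans le_yx; apply: IHl => //; apply: mem_head.
Qed.

Lemma head_sorted_geq l a : sorted geq l -> a \in l -> a <= head 0 l.
Proof.
case: l => // x l /= path_l; rewrite inE => /orP[/eqP-> //|a_l].
have geq_trans : transitive geq by move=> u v w /= ? /leq_trans; apply.
exact: (allP (order_path_min geq_trans path_l)).
Qed.

Lemma two_values_nseq v m s : m < v -> sorted overpart_step s ->
  all (fun x => (x == (v, false)) || (x == (m, false))) s ->
  s = nseq (count_mem v (parts s)) (v, false) ++ nseq (count_mem m (parts s)) (m, false).
Proof.
move=> lt_mv; elim: s => //= x s IHs path_s /andP[/orP[]/eqP def_x all_s].
  rewrite {1}(IHs (path_sorted path_s) all_s) def_x /= eqxx.
  by rewrite (gtn_eqF lt_mv).
have all_m : all (pred1 (m, false)) s.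
  apply/allP => y y_s; have := allP all_s y y_s => /orP[/eqP def_y|//].
  by have := allP (path_overpart_le path_s) y y_s; rewrite def_x def_y /=; lia.
rewrite (all_pred1P _ _ all_m) def_x /parts /unzip1 map_nseq !count_nseq /=.
by rewrite (ltn_eqF lt_mv) eqxx mul1n.
Qed.

Definition largest_part (s : seq (nat * bool)) : nat := head 0 (parts s).

(** Once the largest and smallest parts differ, this equals the smallest part exactly when there are
    two part sizes. The default 0 arises only when there are fewer. *)
Definition second_largest_part (s : seq (nat * bool)) : nat :=
  head 0 [seq a <- parts s | a != largest_part s].

Definition head_overlined (s : seq (nat * bool)) : bool := (head (0, false) s).2.

Section SptMod4.

Variable n : nat.
Hypothesis n_gt0 : 0 < n.

Lemma spt2_overpartition_cons s : s \in spt2_overpartitions n ->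
  exists x r, s = x :: r.
Proof.
rewrite mem_spt2_overpartitions => /andP[/and3P[_ _ /eqP sum_s] _].
by case: s sum_s => [eq0|x r _]; [move: n_gt0; rewrite -eq0 | exists x, r].
Qed.

Lemma smallest_part_in s : s \in spt2_overpartitions n -> smallest_part s \in parts s.
Proof.
by case/spt2_overpartition_cons=> x [r ->]; rewrite /smallest_part /=; apply: mem_last.
Qed.

(** The only part size is the smallest part, which is not overlined, so these overpartitions are
    exactly the plain d^j with d even. *)
Lemma sum_one_size :
  \sum_(s <- spt2_overpartitions n | largest_part s == smallest_part s) smallest_mult s =
  \sum_(x <- pairs n | (x.1 * x.2 == n) && ~~ odd x.1) x.2.
Proof.
rewrite -big_filter -[RHS]big_filter.
apply: (sum_bij_seq (f := fun s => (smallest_part s, smallest_mult s))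
  (g := fun x => nseq x.2 (x.1, false))).
- by rewrite filter_uniq // spt2_overpartitions_uniq.
- by rewrite filter_uniq // pairs_uniq.
- move=> s; rewrite mem_filter => /andP[/eqP eq_m s_n].
  have m_s := smallest_part_in s_n; move: s_n; rewrite mem_spt2_overpartitions.
  move=> /andP[/and3P[sorted_s pos_s /eqP sum_s] /andP[even_m not_over]].
  have all_m : all (pred1 (smallest_part s, false)) s.
    apply/allP => -[a b] ab_s; have a_s : a \in parts s := map_f fst ab_s.
    have: a = smallest_part s.
      apply/eqP; rewrite eqn_leq (last_sorted_geq (sorted_parts sorted_s) a_s) andbT.
      by rewrite -eq_m (head_sorted_geq (sorted_parts sorted_s) a_s).
    move=> eq_a; move: ab_s; rewrite eq_a; case: b => //= ab_s.
    by rewrite ab_s in not_over.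
  have def_s := all_pred1P _ _ all_m.
  have eq_mult : smallest_mult s = size s.
    by rewrite /smallest_mult {2}def_s /parts /unzip1 map_nseq count_nseq /= eqxx mul1n.
  rewrite eq_mult; split=> //.
  have size_gt0 : 0 < size s by case: (s) m_s.
  have m_gt0 : 0 < smallest_part s := allP pos_s _ m_s.
  have eq_n : smallest_part s * size s = n.
    by rewrite -sum_s {3}def_s /parts /unzip1 map_nseq sumn_nseq.
  rewrite mem_filter /= eq_n eqxx even_m mem_pairs m_gt0 size_gt0 /=.
  by rewrite -eq_n leq_pmulr // leq_pmull.
move=> [d j]; rewrite mem_filter mem_pairs /=.
move=> /andP[/andP[/eqP eq_n even_d] /andP[/andP[d0 _] /andP[j0 _]]].
have parts_nseq : parts (nseq j (d, false)) = nseq j d by rewrite /parts /unzip1 map_nseq.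
have last_nseq : last 0 (nseq j d) = d.
  by case: (j) j0 => // k _ /=; elim: k => //= k IHk.
rewrite mem_filter /largest_part /smallest_mult /smallest_part parts_nseq last_nseq.
rewrite count_nseq /= eqxx mul1n; split=> //.
rewrite mem_spt2_overpartitions /is_overpartition /smallest_part_even_nonoverlined.
rewrite /smallest_part parts_nseq last_nseq even_d sumn_nseq eq_n eqxx all_nseq d0 orbT.
rewrite mem_nseq xpair_eqE andbF !andbT; apply/andP; split.
  by case: (j) j0 => //= k _; rewrite eqxx.
by case: (j) j0 => //= k _; rewrite andbT; elim: k => //= k ->; rewrite /overpart_step /= leqnn.
Qed.

(** These have at least three part sizes. Toggling the second largest one affects neither the head
    nor the smallest part, so it pairs overpartitions of equal weight. *)
Lemma even_sum_many_sizes : 2 %| \sum_(s <- spt2_overpartitions n |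
   [&& largest_part s != smallest_part s, ~~ head_overlined s
     & second_largest_part s != smallest_part s]) smallest_mult s.
Proof.
rewrite -big_filter.
apply: (sum_involution_dvd (f := fun s => toggle (second_largest_part s) s)).
  by rewrite filter_uniq // spt2_overpartitions_uniq.
move=> s; rewrite mem_filter => /andP[/and3P[ne1 not_over ne2] s_n].
have second_in : second_largest_part s \in [seq a <- parts s | a != largest_part s].
  have : smallest_part s \in [seq a <- parts s | a != largest_part s].
    by rewrite mem_filter eq_sym ne1 smallest_part_in.
  by rewrite /second_largest_part; case: [seq _ <- _ | _] => //= a l _; apply: mem_head.
move: second_in; rewrite mem_filter => /andP[ne12 second_in].
have eq_parts := parts_toggle (second_largest_part s) s.
split.
- rewrite mem_filter toggle_spt2_overpartitions //.
  rewrite /second_largest_part /largest_part /smallest_part eq_parts.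
  rewrite -/(largest_part s) -/(smallest_part s) -/(second_largest_part s) ne1 ne2.
  rewrite andbT andbT /=; case/spt2_overpartition_cons: s_n => x [r def_s].
  move: ne12 not_over; rewrite def_s /= /largest_part /=.
  by rewrite eq_sym => /negPf->.
- by rewrite {1}/second_largest_part /largest_part eq_parts toggleK.
- exact: toggle_neq.
by rewrite /smallest_mult /smallest_part eq_parts addnn dvdn2 odd_double.
Qed.

Lemma sum_head_overlined :
  \sum_(s <- spt2_overpartitions n |
     (largest_part s != smallest_part s) && head_overlined s) smallest_mult s =
  \sum_(s <- spt2_overpartitions n |
     (largest_part s != smallest_part s) && ~~ head_overlined s) smallest_mult s.
Proof.
pose f s := toggle (largest_part s) s.
have eq_parts s : parts (f s) = parts s := parts_toggle _ _.
have fK s : f (f s) = s by rewrite {1}/f /largest_part eq_parts toggleK.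
have head_f s : s \in spt2_overpartitions n -> head_overlined (f s) = ~~ head_overlined s.
  by case/spt2_overpartition_cons=> -[a b] [r ->]; rewrite /f /largest_part /= eqxx.
rewrite -big_filter -[RHS]big_filter.
apply: (sum_bij_seq (f := f) (g := f)).
- by rewrite filter_uniq // spt2_overpartitions_uniq.
- by rewrite filter_uniq // spt2_overpartitions_uniq.
- move=> s; rewrite mem_filter => /andP[/andP[ne over] s_n]; split=> //.
    rewrite mem_filter head_f // over /largest_part /smallest_part eq_parts ne /=.
    exact: toggle_spt2_overpartitions.
  by rewrite /smallest_mult /smallest_part eq_parts.
move=> s; rewrite mem_filter => /andP[/andP[ne over] s_n]; split=> //.
rewrite mem_filter head_f // over /largest_part /smallest_part eq_parts ne /=.
exact: toggle_spt2_overpartitions.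
Qed.

(** With neither the largest nor the smallest part overlined, no entry is, so such an overpartition
    is a plain a^i b^j with weight j. *)
Lemma sum_two_sizes :
  \sum_(s <- spt2_overpartitions n |
     [&& largest_part s != smallest_part s, ~~ head_overlined s
       & second_largest_part s == smallest_part s]) smallest_mult s =
  \sum_(q <- quads n | (q.2.1 < q.1.1) && ~~ odd q.2.1) q.2.2.
Proof.
rewrite -big_filter -[RHS]big_filter.
apply: (sum_bij_seq
  (f := fun s => ((largest_part s, count_mem (largest_part s) (parts s)),
                  (smallest_part s, smallest_mult s)))
  (g := fun q => nseq q.1.2 (q.1.1, false) ++ nseq q.2.2 (q.2.1, false))).
- by rewrite filter_uniq // spt2_overpartitions_uniq.
- by rewrite filter_uniq // quads_uniq.
- move=> s; rewrite mem_filter => /andP[/and3P[ne1 not_over /eqP eq2] s_n].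
  have m_s := smallest_part_in s_n.
  have [x [r def_s]] := spt2_overpartition_cons s_n.
  have v_s : largest_part s \in parts s by rewrite def_s; apply: mem_head.
  move: s_n; rewrite mem_spt2_overpartitions.
  move=> /andP[/and3P[sorted_s pos_s /eqP sum_s] /andP[even_m m_over]].
  have sorted_p := sorted_parts sorted_s.
  have lt_mv : smallest_part s < largest_part s.
    by rewrite ltn_neqAle eq_sym ne1 (last_sorted_geq sorted_p v_s).
  have all_s : all (fun y => (y == (largest_part s, false)) || (y == (smallest_part s, false))) s.
    apply/allP => -[a b] ab_s; have a_s : a \in parts s := map_f fst ab_s.
    rewrite !xpair_eqE; have [eq_a|ne_a] := eqVneq a (largest_part s).
      case: b ab_s => //; rewrite eq_a def_s inE => /orP[/eqP xv|v_r].
        by move: not_over; rewrite def_s /head_overlined /= -xv.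
      by move: sorted_s; rewrite def_s => /path_overpart_head; rewrite v_r.
    have eq_a : a = smallest_part s.
      apply/eqP; rewrite eqn_leq (last_sorted_geq sorted_p a_s) andbT -eq2.
      apply: head_sorted_geq; last by rewrite mem_filter ne_a.
      apply: sorted_filter => //.
      by move=> u v w /= ? /leq_trans; apply.
    by rewrite eq_a eqxx; case: b ab_s => //; rewrite eq_a (negPf m_over).
  have def2_s := two_values_nseq lt_mv sorted_s all_s.
  split=> //.
  rewrite mem_filter lt_mv even_m mem_quads /=; apply/and5P; split.
  - by rewrite (leq_ltn_trans _ lt_mv).
  - by rewrite -has_count has_pred1.
  - exact: (allP pos_s).
  - by rewrite -has_count has_pred1.
  apply/eqP; rewrite -[RHS]sum_s [in RHS]def2_s /parts /unzip1 map_cat !map_nseq.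
  by rewrite sumn_cat !sumn_nseq.
move=> [[a i] [b j]]; rewrite mem_filter mem_quads /=.
move=> /andP[/andP[lt_ba even_b] /and5P[a0 i0 b0 j0 /eqP eq_n]].
set s := _ ++ _.
have eq_parts : parts s = nseq i a ++ nseq j b.
  by rewrite /parts /unzip1 map_cat !map_nseq.
have eq_last : smallest_part s = b.
  rewrite /smallest_part eq_parts last_cat; case: (j) j0 => // k _ /=.
  by elim: k.
have eq_head : largest_part s = a by rewrite /largest_part eq_parts; case: (i) i0.
have eq_second : second_largest_part s = b.
  rewrite /second_largest_part eq_head eq_parts filter_cat !filter_nseq.
  by rewrite eqxx (ltn_eqF lt_ba); case: (j) j0.
have not_over : head_overlined s = false by rewrite /s; case: (i) i0.
rewrite /smallest_mult eq_last eq_head eq_parts !count_cat !count_nseq /=.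
rewrite !eqxx (gtn_eqF lt_ba) (ltn_eqF lt_ba) !mul0n !mul1n addn0; split=> //.
rewrite mem_filter eq_last eq_head eq_second not_over eqxx (gtn_eqF lt_ba) /=.
rewrite mem_spt2_overpartitions /is_overpartition /smallest_part_even_nonoverlined.
rewrite eq_last eq_parts even_b sumn_cat !sumn_nseq eq_n eqxx.
rewrite all_cat !all_nseq a0 b0 !orbT mem_cat !mem_nseq !xpair_eqE !andbF !andbT /=.
have path_nseq c k : path overpart_step (c, false) (nseq k (c, false)).
  by elim: k => //= k ->; rewrite /overpart_step /= leqnn.
rewrite /s; case: (i) i0 => // k _ /=; rewrite cat_path path_nseq /=.
have -> : last (a, false) (nseq k (a, false)) = (a, false) by elim: k.
by case: (j) j0 => //= l _; rewrite path_nseq /overpart_step /= ltnW.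
Qed.

(** From two part sizes on, toggling the largest part contributes a factor 2. The rest then matters
    only modulo 2, where three or more sizes vanish. *)
Lemma spt2bar_mod4 :
  spt2bar n = \sum_(x <- pairs n | (x.1 * x.2 == n) && ~~ odd x.1) x.2
    + 2 * \sum_(q <- quads n | (q.2.1 < q.1.1) && ~~ odd q.2.1) q.2.2 %[mod 4].
Proof.
rewrite spt2bar_sum (bigID (fun s => largest_part s == smallest_part s)) /= sum_one_size.
rewrite (bigID head_overlined) /= sum_head_overlined addnn -mul2n.
rewrite (bigID (fun s => second_largest_part s == smallest_part s)) /=.
rewrite (eq_bigl _ _ (fun s => esym (andbA _ _ _))) sum_two_sizes.
rewrite [X in 2 * (_ + X)](eq_bigl _ _ (fun s => esym (andbA _ _ _))).
have /dvdnP[c ->] := even_sum_many_sizes.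
by rewrite mulnDr addnA (mulnC c) mulnA addnC mulnC modnMDl.
Qed.

End SptMod4.

(** * The form x^2 + 2 y^2 *)

Lemma sqr_mod8 x : x ^ 2 %% 8 = if odd x then 1 else if 4 %| x then 0 else 4.
Proof.
rewrite {2 3}(divn_eq x 8) oddD oddM andbF /= dvdn_addr ?dvdn_mull // -modnXm.
by case: (x %% 8) (ltn_pmod x (isT : 0 < 8)) => [|[|[|[|[|[|[|[|]]]]]]]].
Qed.

Lemma odd_form_mod8 x y : odd (x ^ 2 + 2 * y ^ 2) ->
  (x ^ 2 + 2 * y ^ 2) %% 8 = 1 \/ (x ^ 2 + 2 * y ^ 2) %% 8 = 3.
Proof.
have := sqr_mod8 x; have := sqr_mod8 y.
move: (x ^ 2) (y ^ 2) => s t; do 4?case: ifP => _; lia.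
Qed.

Lemma sqrt_floor n : exists r, r ^ 2 <= n < r.+1 ^ 2.
Proof.
elim: n => [|n [r /andP[le_rn lt_nr]]]; first by exists 0.
have [lt_n|le_n] := ltnP n.+1 (r.+1 ^ 2).
  by exists r; rewrite lt_n (leqW le_rn).
exists r.+1; rewrite le_n (leq_ltn_trans lt_nr) //.
by rewrite ltn_exp2r.
Qed.

(** Modulo p, uy = -vx or uy = vx gives u^2 y^2 = v^2 x^2 = -2 v^2 y^2. The two signs are separate
    cases because differences of naturals must be taken in the right order. *)
Lemma form_transfer p x y u v : p %| x ^ 2 + 2 * y ^ 2 ->
  p %| u * y + v * x \/ u * y = v * x %[mod p] -> p %| y ^ 2 * (u ^ 2 + 2 * v ^ 2).
Proof.
move=> p_form [p_lin|eq_lin].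
  have: p %| y ^ 2 * (u ^ 2 + 2 * v ^ 2) + v * x * (u * y + v * x).
    rewrite (_ : _ + _ = u * y * (u * y + v * x) + v ^ 2 * (x ^ 2 + 2 * y ^ 2)).
      by rewrite dvdn_add // dvdn_mull.
    by lia.
  by rewrite dvdn_addl // dvdn_mull.
have eq_sq : (u * y) ^ 2 = (v * x) ^ 2 %[mod p] by rewrite -modnXm eq_lin modnXm.
rewrite (_ : _ * _ = (u * y) ^ 2 + 2 * v ^ 2 * y ^ 2); last by lia.
rewrite /dvdn -modnDml eq_sq modnDml.
rewrite (_ : _ + _ = v ^ 2 * (x ^ 2 + 2 * y ^ 2)); last by lia.
by rewrite -/(dvdn _ _) dvdn_mull.
Qed.

(* Thue's pigeonhole argument: if [p] did not divide [y], one of [p], [2 * p]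
   would be [u ^ 2 + 2 * v ^ 2], which is impossible modulo 8. *)
Lemma prime_dvd_form p x y : prime p -> p = 5 %[mod 8] \/ p = 7 %[mod 8] ->
  p %| x ^ 2 + 2 * y ^ 2 -> p %| y.
Proof.
move=> p_prime p_mod p_form; have p_gt0 := prime_gt0 p_prime.
have [//|p_ndiv_y] := boolP (p %| y).
have [r /andP[le_rp lt_pr]] := sqrt_floor p.
pose f (w : 'I_r.+1 * 'I_r.+1) : 'I_p := Ordinal (ltn_pmod (w.1 * y + w.2 * x) p_gt0).
(* There are (r + 1)^2 > p pairs and p residues, so two pairs collide. *)
have /injectivePn[[u1 v1] [[u2 v2] ne_w /(congr1 val) /= eq_f]] : ~~ injectiveb f.
  apply: contraL lt_pr => /injectiveP /leq_card.
  by rewrite card_prod !card_ord -leqNgt.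
(* Here u^2 + 2v^2 is a positive multiple of p, at most 3r^2 < 3p, hence p or 2p. The strict bound
   holds because squares are 0, 1 or 4 mod 8, so p is not a square. *)
have dvd_form (u v : nat) : u <= r -> v <= r -> (0 < u) || (0 < v) ->
    p %| y ^ 2 * (u ^ 2 + 2 * v ^ 2) -> False.
  move=> le_ur le_vr uv_gt0.
  rewrite Euclid_dvdM // Euclid_dvdX // (negPf p_ndiv_y) /= => /dvdnP[c eq_c].
  have le_u : u ^ 2 <= r ^ 2 by rewrite leq_exp2r.
  have le_v : v ^ 2 <= r ^ 2 by rewrite leq_exp2r.
  have form_gt0 : 0 < u ^ 2 + 2 * v ^ 2.
    by rewrite addn_gt0 muln_gt0 !expn_gt0 !orbF.
  have lt_rp : r ^ 2 < p.
    rewrite ltn_neqAle le_rp andbT; apply/eqP => eq_rp.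
    by case: p_mod; rewrite -eq_rp sqr_mod8; do 2?case: ifP => //.
  have c_lt3 : c < 3.
    rewrite -(ltn_pmul2r p_gt0) -eq_c.
    by move: (u ^ 2) (v ^ 2) (r ^ 2) le_u le_v lt_rp => s t q; clear; lia.
  have no_small w z : w ^ 2 + 2 * z ^ 2 <> p.
    move=> eq_p; have := @odd_form_mod8 w z; rewrite eq_p; clear -p_mod; lia.
  case: c eq_c c_lt3 => [|[|[|//]]] eq_c _.
  - by rewrite eq_c in form_gt0.
  - by apply: (no_small u v); rewrite eq_c mul1n.
  (* From 2p = u^2 + 2v^2, u is even and p = v^2 + 2(u/2)^2. *)
  apply: (no_small v u./2).
  have even_u : ~~ odd u.
    by have := oddD (u ^ 2) (2 * v ^ 2); rewrite eq_c oddX !oddM /= addbF => <-.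
  have eq_u : u ^ 2 = 4 * (u./2) ^ 2.
    by rewrite -{1}(even_halfK even_u) -muln2 expnMn mulnC.
  by move: eq_c; rewrite eq_u; move: (u./2 ^ 2) (v ^ 2) => s t; clear; lia.
have collide (a b c d : 'I_r.+1) : c <= a -> (a, b) != (c, d) ->
    a * y + b * x = c * y + d * x %[mod p] -> False.
  move=> le_ca ne eq_mod; have le_r (w z : 'I_r.+1) : w - z <= r.
    by rewrite (leq_trans (leq_subr _ _)) // -ltnS.
  have ne_nat : (a != c :> nat) || (b != d :> nat).
    by move: ne; rewrite xpair_eqE negb_and.
  have [le_db|lt_bd] := leqP d b.
    apply: (dvd_form (a - c) (b - d)) => //.
      by rewrite !subn_gt0 !ltn_neqAle le_ca le_db !andbT (eq_sym (c : nat)) (eq_sym (d : nat)).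
    apply: (form_transfer p_form); left; move/eqP: eq_mod.
    rewrite eqn_mod_dvd ?leq_add ?leq_mul //.
    by rewrite -{1}(subnKC le_ca) -{1}(subnKC le_db) !mulnDl addnACA addKn.
  apply: (dvd_form (a - c) (d - b)) => //; first by rewrite !subn_gt0 lt_bd orbT.
  apply: (form_transfer p_form); right; apply/eqP.
  (* Adding cy + bx to both sides of (a - c)y = (d - b)x restores the collision congruence without
     subtraction. *)
  rewrite -(eqn_modDl (c * y + b * x)).
  rewrite addnAC -mulnDl subnKC // -addnA -mulnDl subnKC 1?ltnW //.
  exact/eqP.
have [le21|/ltnW le12] := leqP u2 u1; first by case: (collide _ _ _ _ le21 ne_w eq_f).
by case: (collide u2 v2 u1 v1 le12 _ (esym eq_f)); rewrite eq_sym.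
Qed.

(** Descent: if p divides the form, it divides y and then x, so p^2 factors out and leaves a smaller
    value of the form. After k rounds a single factor p is left, and one more round would make p
    divide c. *)
Lemma odd_power_not_form p c k x y : prime p -> p = 5 %[mod 8] \/ p = 7 %[mod 8] ->
  ~~ (p %| c) -> x ^ 2 + 2 * y ^ 2 <> p ^ (2 * k + 1) * c.
Proof.
move=> p_prime p_mod p_ndiv_c.
have descend u v : p %| u ^ 2 + 2 * v ^ 2 ->
    exists u' v', u ^ 2 + 2 * v ^ 2 = p ^ 2 * (u' ^ 2 + 2 * v' ^ 2).
  move=> p_form; have p_v := prime_dvd_form p_prime p_mod p_form.
  have p_u : p %| u.
    have p_2v : p %| 2 * v ^ 2 by apply/dvdn_mull/dvdn_exp.
    by move: p_form; rewrite dvdn_addl // Euclid_dvdX // andbT.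
  case/dvdnP: p_u p_v => u' -> /dvdnP[v' ->]; exists u', v'.
  by rewrite mulnDr !expnMn; lia.
elim: k x y => [|k IHk] x y eq_form; have [|u [v eq_uv]] := descend x y.
- by rewrite eq_form dvdn_mulr // dvdn_exp.
- move/eqP: eq_form; rewrite eq_uv expn1 -mulnn -mulnA eqn_pmul2l ?prime_gt0 //.
  by move/eqP => eq_c; move: p_ndiv_c; rewrite -eq_c dvdn_mulr.
- by rewrite eq_form dvdn_mulr // expnD dvdn_mull.
move/eqP: eq_form; rewrite eq_uv (_ : 2 * k.+1 + 1 = 2 + (2 * k + 1)); last by lia.
rewrite expnD -mulnA eqn_pmul2l ?expn_gt0 ?prime_gt0 // => /eqP.
exact: IHk.
Qed.

Lemma pow2_mul_sqr e x : exists z, 2 ^ e * x ^ 2 = z ^ 2 \/ 2 ^ e * x ^ 2 = 2 * z ^ 2.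
Proof.
exists (2 ^ e./2 * x); rewrite expnMn -expnM muln2 -{1 3}(odd_double_half e).
by case: (odd e); [right; rewrite expnD mulnA | left].
Qed.

Lemma sum_two_sqr_even x y : 4 %| x ^ 2 + y ^ 2 ->
  exists u v, x ^ 2 + y ^ 2 = 4 * (u ^ 2 + v ^ 2).
Proof.
move=> dvd4; have := sqr_mod8 x; have := sqr_mod8 y.
case odd_y: (odd y); case odd_x: (odd x).
- by move: (x ^ 2) (y ^ 2) dvd4 => s t; clear; lia.
- by move: (x ^ 2) (y ^ 2) dvd4 => s t; clear; case: ifP => _; lia.
- by move: (x ^ 2) (y ^ 2) dvd4 => s t; clear; case: ifP => _; lia.
move=> _ _; exists x./2, y./2.
rewrite -{1}(even_halfK (negbT odd_x)) -{1}(even_halfK (negbT odd_y)) -!muln2.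
by rewrite !expnMn mulnDr ![4 * _]mulnC.
Qed.

(** Absorbing even powers of 2 leaves z^2 + w^2, 2z^2 + 2w^2 or the excluded mixed form. In the
    first two cases, halving z and w gives a sum of two squares equal to 2M or M. This is
    impossible, since 2M is 6 mod 8 and M is 3 mod 4. *)
Lemma no_form_8M (M : nat) : M = 3 %[mod 4] ->
  (forall x y, x ^ 2 + 2 * y ^ 2 <> 8 * M) ->
  forall e f x y, 2 ^ e * x ^ 2 + 2 ^ f * y ^ 2 <> 8 * M.
Proof.
move=> M_mod no_form e f x y.
have [z [->|->]] := pow2_mul_sqr e x; have [w [->|->]] := pow2_mul_sqr f y.
- move=> eq_M; have [|u [v eq_uv]] := @sum_two_sqr_even z w.
    by rewrite eq_M -[8]/(4 * 2) -mulnA dvdn_mulr.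
  have := sqr_mod8 u; have := sqr_mod8 v.
  move: eq_uv eq_M; move: (z ^ 2 + _) (u ^ 2) (v ^ 2) => q s t -> eq_M.
  by clear -M_mod eq_M; do 4?case: ifP => _; lia.
- exact: no_form.
- by rewrite addnC; apply: no_form.
move=> eq_M; have [|u [v eq_uv]] := @sum_two_sqr_even z w.
  by rewrite -(@dvdn_pmul2l 2) // mulnDr eq_M dvdn_mulr.
have := sqr_mod8 u; have := sqr_mod8 v.
move: eq_uv eq_M; rewrite -mulnDr; move: (z ^ 2 + _) (u ^ 2) (v ^ 2) => q s t -> eq_M.
by clear -M_mod eq_M; do 4?case: ifP => _; lia.
Qed.

(** * The congruence *)

Lemma odd_sum_count (T : Type) (P : pred T) (w : T -> nat) (s : seq T) :
  odd (\sum_(x <- s | P x) w x) = odd (count (fun x => P x && odd (w x)) s).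
Proof.
elim: s => [|x s IHs]; first by rewrite big_nil.
by rewrite big_cons /= oddD -IHs; case: (P x); rewrite /= ?oddD ?oddb.
Qed.

Lemma spt2bar_8M (M : nat) : M = 3 %[mod 4] ->
  (forall x y, x ^ 2 + 2 * y ^ 2 <> 8 * M) -> spt2bar (8 * M) = 0 %[mod 4].
Proof.
move=> M_mod no_form; have no_rep := no_form_8M M_mod no_form.
rewrite spt2bar_mod4; last by lia.
apply/eqP; rewrite mod0n -/(4 %| _) dvdn_add //.
  by rewrite -big_filter dvd4_sum_one_size.
rewrite -[4]/(2 * 2) dvdn_pmul2l // dvdn2 odd_sum_count.
rewrite (eq_count (a2 := fun q => [&& q.2.1 < q.1.1, ~~ odd q.2.1 & odd q.2.2])).
  exact: even_count_two_sizes.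
by move=> q; rewrite -andbA.
Qed.

Theorem theorem1p3 (p : nat) (p_prime : prime p) (p_gt3 : 3 < p)
    (p_mod8 : p = 5 %[mod 8] \/ p = 7 %[mod 8])
    (k m : nat) (p_ndiv_m : ~~ (p %| m)) :
  spt2bar (32 * p ^ (2 * k + 1) * m + 24 * p ^ (2 * k + 2)) = 0 %[mod 4].
Proof.
have odd_p : odd p by lia.
have -> : 32 * p ^ (2 * k + 1) * m + 24 * p ^ (2 * k + 2) =
    8 * (p ^ (2 * k + 1) * (4 * m + 3 * p)).
  by rewrite [2 * k + 2]addnS expnS; move: (p ^ (2 * k + 1)) => q; lia.
apply: spt2bar_8M => [|x y].
  (* Here M = 4 p^(2k+1) m + 3 p^(2k+2), and p^(2k+2) is an odd square, so M is 3 mod 4. *)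
  have := sqr_mod8 (p ^ k.+1); rewrite oddX odd_p orbT -expnM.
  rewrite (_ : k.+1 * 2 = (2 * k + 1).+1) ?expnS; last by lia.
  move: (p ^ (2 * k + 1)) => q; rewrite mulnDr (mulnCA q 4) (mulnCA q 3) (mulnC q p).
  by move: (p * q) (q * m) => s t; clear; lia.
(* The factor 8 joins the cofactor, leaving 8(4m + 3p), which p does not divide because p is odd and
   does not divide m. *)
rewrite mulnCA; apply: odd_power_not_form => //.
rewrite Euclid_dvdM // (dvdn_addl _ (dvdn_mull 3 (dvdnn p))) Euclid_dvdM // (negPf p_ndiv_m) orbF.
have ndvd2 : ~~ (p %| 2) by apply: contraL p_gt3 => /dvdn_leq -/(_ isT); lia.
by rewrite -[8]/(2 ^ 3) -[4]/(2 ^ 2) !Euclid_dvdX // (negPf ndvd2).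
Qed.
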